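(* Let $\mathcal{E}$ be an extriangulated category and let $C\subseteq as(\mathcal{E})$ be a subset. For a nonempty irreducible closed subset $Z\subseteq Esp_C(\mathcal{E})$ put $\mathcal{P}(Z)=\{E\in\mathcal{E}: U_C(E)\cap Z\neq\emptyset\}$. Then $Esp_C(\mathcal{E})$ is a sober space if and only if $\mathcal{P}(Z)\in C$ for every nonempty irreducible closed subset $Z\subseteq Esp_C(\mathcal{E})$. When this holds, one has $Z=\overline{\{\mathcal{P}(Z)\}}$ for every such $Z$. In particular, $Esp_{as(\mathcal{E})}(\mathcal{E})$ and $Esp_{Th(\mathcal{E})}(\mathcal{E})$ are always sober.
   Context: $\mathcal{E}$ is an extriangulated category (in the sense of Nakaoka–Palu), with its class of conflations $L\to M\to N$. $as(\mathcal{E})$ denotes the collection of non-empty full subcategories of $\mathcal{E}$ closed under finite direct sums and direct summands (hence containing $0$). $Th(\mathcal{E})\subseteq as(\mathcal{E})$ is the collection of thick subcategories: non-empty full additive subcategories closed under direct summands and with the 2-out-of-3 property for conflations (if two of $L,M,N$ in a conflation $L\to M\to N$ lie in the subcategory, so does the third). For $C\subseteq as(\mathcal{E})$ and a class $\mathcal{X}$ of objects put $Z_C(\mathcal{X})=\{\mathcal{P}\in C:\mathcal{P}\cap\mathcal{X}=\emptyset\}$ and $U_C(\mathcal{X})=C\setminus Z_C(\mathcal{X})$. The sets $Z_C(\mathcal{X})$ are the closed sets of a topology on $C$; the resulting space is $Esp_C(\mathcal{E})$. For an object $E$, $U_C(E):=U_C(\{E\})=\{\mathcal{P}\in C: E\in\mathcal{P}\}$.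 A space is sober if every nonempty irreducible closed subset has a unique generic point. *)

(* Defs.v *)
From HB Require Import structures.
From mathcomp Require Import all_boot all_order all_algebra.
From mathcomp Require Import all_classical.
From mathcomp Require Import topology.

Set Implicit Arguments.
Unset Strict Implicit.
Unset Printing Implicit Defensive.

Import GRing.Theory.
Local Open Scope classical_set_scope.
Local Open Scope ring_scope.

Record preadditiveCat := PreadditiveCat {
  obj :> Type;
  hom : obj -> obj -> zmodType;
  idm : forall A, hom A A;
  comp : forall A B C, hom B C -> hom A B -> hom A C;
  comp_assoc : forall A B C D (h : hom C D) (g : hom B C) (f : hom A B),
    comp h (comp g f) = comp (comp h g) f;
  comp_idl : forall A B (f : hom A B), comp (idm B) f = f;
  comp_idr : forall A B (f : hom A B), comp f (idm A) = f;
  comp_addl : forall A B C (g g' : hom B C) (f : hom A B),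
    comp (g + g') f = comp g f + comp g' f;
  comp_addr : forall A B C (g : hom B C) (f f' : hom A B),
    comp g (f + f') = comp g f + comp g f' }.

Arguments idm {p} A.
Arguments comp {p A B C} g f.

Notation "g ∘ f" := (comp g f) (at level 40, left associativity) : ring_scope.

Definition is_iso (E : preadditiveCat) (A B : E) (f : hom A B) :=
  exists g : hom B A, g ∘ f = idm A /\ f ∘ g = idm B.

Definition is_zero_obj (E : preadditiveCat) (Z : E) := idm Z = 0.

Record biproduct (E : preadditiveCat) (A B : E) := Biproduct {
  bp_obj :> obj E;
  bp_in1 : hom A bp_obj;
  bp_in2 : hom B bp_obj;
  bp_pr1 : hom bp_obj A;
  bp_pr2 : hom bp_obj B;
  bp_pr1_in1 : bp_pr1 ∘ bp_in1 = idm A;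
  bp_pr2_in2 : bp_pr2 ∘ bp_in2 = idm B;
  bp_pr1_in2 : bp_pr1 ∘ bp_in2 = 0;
  bp_pr2_in1 : bp_pr2 ∘ bp_in1 = 0;
  bp_total : bp_in1 ∘ bp_pr1 + bp_in2 ∘ bp_pr2 = idm bp_obj }.

Record additiveCat := AdditiveCat {
  additive_pre :> preadditiveCat;
  has_zero_obj : exists Z : additive_pre, is_zero_obj Z;
  has_biproduct : forall A B : additive_pre, inhabited (biproduct A B) }.

Definition hom_dsum (E : preadditiveCat) (A A' B B' : E)
    (SA : biproduct A A') (SB : biproduct B B')
    (f : hom A B) (f' : hom A' B') : hom SA SB :=
  bp_in1 SB ∘ f ∘ bp_pr1 SA + bp_in2 SB ∘ f' ∘ bp_pr2 SA.

(* Extriangulated categories in the sense of Nakaoka and Palu; (ET1)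
   is [biadditiveFunctor], (ET2) is [additive_realization]. *)

(* [Ext C A] is the group E(C, A) of E-extensions of C by A; [push a d] and
   [pull c d] are a_* d and c^* d. *)
Record biadditiveFunctor (E : additiveCat) := BiadditiveFunctor {
  Ext :> E -> E -> zmodType;
  push : forall C A A', hom A A' -> Ext C A -> Ext C A';
  pull : forall C C' A, hom C' C -> Ext C A -> Ext C' A;
  push_id : forall C A (d : Ext C A), push (idm A) d = d;
  push_comp : forall C A A' A'' (a' : hom A' A'') (a : hom A A') (d : Ext C A),
    push (a' ∘ a) d = push a' (push a d);
  pull_id : forall C A (d : Ext C A), pull (idm C) d = d;
  pull_comp : forall C C' C'' A (c : hom C' C) (c' : hom C'' C') (d : Ext C A),
    pull (c ∘ c') d = pull c' (pull c d);
  push_pull : forall C C' A A' (a : hom A A') (c : hom C' C) (d : Ext C A),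
    push a (pull c d) = pull c (push a d);
  pushD : forall C A A' (a : hom A A') (d d' : Ext C A),
    push a (d + d') = push a d + push a d';
  pullD : forall C C' A (c : hom C' C) (d d' : Ext C A),
    pull c (d + d') = pull c d + pull c d';
  push_add : forall C A A' (a a' : hom A A') (d : Ext C A),
    push (a + a') d = push a d + push a' d;
  pull_add : forall C C' A (c c' : hom C' C) (d : Ext C A),
    pull (c + c') d = pull c d + pull c' d }.

Arguments push {E b C A A'} a d.
Arguments pull {E b C C' A} c d.

(* The element of E(C (+) C', A (+) A') with components (d, 0, 0, d'). *)
Definition ext_dsum (E : additiveCat) (F : biadditiveFunctor E) (A A' C C' : E)
    (SA : biproduct A A') (SC : biproduct C C')
    (d : F C A) (d' : F C' A') : F SC SA :=
  push (bp_in1 SA) (pull (bp_pr1 SC) d) + push (bp_in2 SA) (pull (bp_pr2 SC) d').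

Definition seq_equiv (E : additiveCat) (A B B' C : E)
    (x : hom A B) (y : hom B C) (x' : hom A B') (y' : hom B' C) :=
  exists b : hom B B', [/\ is_iso b, b ∘ x = x' & y' ∘ b = y].

(* A correspondence s sending each d in E(C, A) to an equivalence class s(d) of
   sequences A -> B -> C is encoded as the relation [s d x y], meaning
   s(d) = [A -x-> B -y-> C]. *)
Definition realization_rel (E : additiveCat) (F : biadditiveFunctor E) :=
  forall A B C : E, F C A -> hom A B -> hom B C -> Prop.

Section Realization.
Variables (E : additiveCat) (F : biadditiveFunctor E).
Variable s : realization_rel F.

Definition realizes (A B C : E) (d : F C A) (x : hom A B) (y : hom B C) : Prop :=
  @s A B C d x y.
Local Notation real := realizes.

Definition real_class := forall (A C : E) (d : F C A),
  exists (B : E) (x : hom A B) (y : hom B C),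
  forall (B' : E) (x' : hom A B') (y' : hom B' C),
    real d x' y' <-> seq_equiv x y x' y'.

(* A morphism of extensions d -> d' is a pair (a, c) with a_* d = c^* d'. *)
Definition real_morph := forall (A B C A' B' C' : E) (d : F C A) (d' : F C' A')
    (x : hom A B) (y : hom B C) (x' : hom A' B') (y' : hom B' C')
    (a : hom A A') (c : hom C C'),
  real d x y -> real d' x' y' -> push a d = pull c d' ->
  exists b : hom B B', b ∘ x = x' ∘ a /\ y' ∘ b = c ∘ y.

Definition real_zero := forall (A C : E) (S : biproduct A C),
  real (0 : F C A) (bp_in1 S) (bp_pr2 S).

Definition real_dsum := forall (A B C A' B' C' : E) (d : F C A) (d' : F C' A')
    (x : hom A B) (y : hom B C) (x' : hom A' B') (y' : hom B' C')
    (SA : biproduct A A') (SB : biproduct B B') (SC : biproduct C C'),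
  real d x y -> real d' x' y' ->
  real (ext_dsum SA SC d d') (hom_dsum SA SB x x') (hom_dsum SB SC y y').

Definition additive_realization :=
  [/\ real_class, real_morph, real_zero & real_dsum].

Definition ET3 := forall (A B C A' B' C' : E) (d : F C A) (d' : F C' A')
    (x : hom A B) (y : hom B C) (x' : hom A' B') (y' : hom B' C')
    (a : hom A A') (b : hom B B'),
  real d x y -> real d' x' y' -> b ∘ x = x' ∘ a ->
  exists c : hom C C', push a d = pull c d' /\ c ∘ y = y' ∘ b.

Definition ET3op := forall (A B C A' B' C' : E) (d : F C A) (d' : F C' A')
    (x : hom A B) (y : hom B C) (x' : hom A' B') (y' : hom B' C')
    (b : hom B B') (c : hom C C'),
  real d x y -> real d' x' y' -> c ∘ y = y' ∘ b ->
  exists a : hom A A', push a d = pull c d' /\ b ∘ x = x' ∘ a.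

(*   A -f-> B -f'-> D
     ||     |g      |u
     A -h-> C -h'-> X
            |g'     |v
            G  ==   G    *)
Definition ET4 := forall (A B C D G : E) (d : F D A) (d' : F G B)
    (f : hom A B) (f' : hom B D) (g : hom B C) (g' : hom C G),
  real d f f' -> real d' g g' ->
  exists (X : E) (h : hom A C) (h' : hom C X) (u : hom D X) (v : hom X G)
         (d'' : F X A),
    [/\ h = g ∘ f, h' ∘ g = u ∘ f' & v ∘ h' = g'] /\
    [/\ real d'' h h', real (push f' d') u v, pull u d'' = d
      & push f d'' = pull v d'].

(*   D -u-> X -v-> G
     ||     |h'    |g'
     D -f'->A -f-> B
            |h     |g
            C  ==  C     *)
Definition ET4op := forall (A B C D G : E) (d : F B D) (d' : F C G)
    (f' : hom D A) (f : hom A B) (g' : hom G B) (g : hom B C),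
  real d f' f -> real d' g' g ->
  exists (X : E) (u : hom D X) (v : hom X G) (h' : hom X A) (h : hom A C)
         (d'' : F C X),
    [/\ h' ∘ u = f', f ∘ h' = g' ∘ v & h = g ∘ f] /\
    [/\ real d'' h' h, real (pull g' d) u v, d' = push v d''
      & push u d = pull g d''].

End Realization.

Record extriangulatedCat := ExtriangulatedCat {
  ext_add :> additiveCat;
  ext_fun : biadditiveFunctor ext_add;
  ext_real : realization_rel ext_fun;
  ext_ET2 : additive_realization ext_real;
  ext_ET3 : ET3 ext_real;
  ext_ET3op : ET3op ext_real;
  ext_ET4 : ET4 ext_real;
  ext_ET4op : ET4op ext_real }.

Definition conflation (E : extriangulatedCat) (L M N : E)
    (x : hom L M) (y : hom M N) :=
  exists d : ext_fun E N L, realizes (@ext_real E) d x y.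

(* A full subcategory is given by its class of objects. Since a biproduct is
   any object with the structure maps, closure under direct summands includes
   closure under isomorphism and, with non-emptiness, membership of 0. *)
Definition as_ (E : additiveCat) : set (set E) :=
  [set P | [/\ P !=set0,
     forall (A B : E) (S : biproduct A B), P A -> P B -> P (bp_obj S)
   & forall (A B : E) (S : biproduct A B), P (bp_obj S) -> P A /\ P B]].
Arguments as_ E : clear implicits.

Definition two_out_of_three (E : extriangulatedCat) (P : set E) :=
  forall (L M N : E) (x : hom L M) (y : hom M N), conflation x y ->
    [/\ P L -> P M -> P N, P L -> P N -> P M & P M -> P N -> P L].

Definition Th (E : extriangulatedCat) : set (set E) :=
  [set P | as_ E P /\ two_out_of_three P].
Arguments Th E : clear implicits.

Lemma Th_as (E : extriangulatedCat) : Th E `<=` as_ E.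
Proof. by move=> P []. Qed.

Lemma comp0l (E : preadditiveCat) (A B C : E) (f : hom A B) :
  (0 : hom B C) ∘ f = 0.
Proof. by apply: (addrI ((0 : hom B C) ∘ f)); rewrite -comp_addl !addr0. Qed.

Lemma comp0r (E : preadditiveCat) (A B C : E) (g : hom B C) :
  g ∘ (0 : hom A B) = 0.
Proof. by apply: (addrI (g ∘ (0 : hom A B))); rewrite -comp_addr !addr0. Qed.

Lemma as_zero (E : additiveCat) (P : set E) (Z : E) :
  as_ E P -> is_zero_obj Z -> P Z.
Proof.
move=> [[A PA] _ Psum] Z0.
have e1 : (idm A) ∘ (idm A) = idm A by rewrite comp_idl.
have e2 : (0 : hom A Z) ∘ (0 : hom Z A) = idm Z by rewrite comp0l Z0.
have e3 : idm A ∘ (0 : hom Z A) = 0 by rewrite comp0r.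
have e4 : (0 : hom A Z) ∘ idm A = 0 by rewrite comp0l.
have e5 : idm A ∘ idm A + (0 : hom Z A) ∘ (0 : hom A Z) = idm A.
  by rewrite comp_idl comp0l addr0.
by have [] := Psum A Z (Biproduct e1 e2 e3 e4 e5).
Qed.

(* The inclusion [C `<=` as_ E] is a parameter of the type because the sets
   [Zc X] are the closed sets of a topology only under this hypothesis. *)
Definition Esp (E : additiveCat) (C : set (set E)) (hC : C `<=` as_ E) : Type :=
  set_type C.

Section EspTopology.
Variables (E : additiveCat) (C : set (set E)) (hC : C `<=` as_ E).

HB.instance Definition _ := Choice.on (Esp hC).

Definition sub_of (P : Esp hC) : set E := val (P : set_type C).

Definition Zc (X : set E) : set (Esp hC) := [set P | sub_of P `&` X = set0].

Definition Uc (X : set E) : set (Esp hC) := ~` Zc X.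

Lemma sub_of_in (P : Esp hC) : C (sub_of P).
Proof. exact: set_valP. Qed.

Lemma UcP (X : set E) (P : Esp hC) : Uc X P <-> sub_of P `&` X !=set0.
Proof. by split=> [/eqP/set0P//|/set0P/eqP]. Qed.

Lemma Uc1P (A : E) (P : Esp hC) : Uc [set A] P <-> sub_of P A.
Proof.
split=> [/UcP[B [PB]] <- //|PA]; apply/UcP.
by exists A.
Qed.

Definition esp_open (U : set (Esp hC)) := exists X, U = Uc X.

Let esp_openT : esp_open setT.
Proof.
have [Z Z0] := has_zero_obj E.
exists [set Z]; apply/seteqP; split=> P // _.
by apply/Uc1P; apply: as_zero (hC (sub_of_in P)) Z0.
Qed.

Let esp_openI : setI_closed esp_open.
Proof.
move=> _ _ [X ->] [Y ->].
exists [set D | exists A B (S : biproduct A B),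
  [/\ X A, Y B & D = bp_obj S]].
apply/seteqP; split=> P.
  move=> [/UcP[A [PA XA]] /UcP[B [PB YB]]]; apply/UcP.
  have [S] := has_biproduct A B.
  have [_ Psum _] := hC (sub_of_in P).
  by exists S; split; [exact: Psum|exists A, B, S].
move=> /UcP[D [PD [A [B [S [XA YB DS]]]]]]; rewrite {}DS in PD.
have [_ _ Psm] := hC (sub_of_in P).
have [PA PB] := Psm _ _ _ PD.
by split; apply/UcP; [exists A|exists B].
Qed.

Let esp_open_bigU (I : Type) (f : I -> set (Esp hC)) :
  (forall i, esp_open (f i)) -> esp_open (\bigcup_i f i).
Proof.
move=> fo; exists [set A | Uc [set A] `<=` \bigcup_i f i].
apply/seteqP; split=> P.
  move=> [i _]; have [X fX] := fo i; rewrite fX => /UcP[A [PA XA]].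
  apply/UcP; exists A; split=> // Q /Uc1P QA; exists i => //.
  by rewrite fX; apply/UcP; exists A.
by move=> /UcP[A [PA +]]; apply; apply/Uc1P.
Qed.

HB.instance Definition _ :=
  isOpenTopological.Build (Esp hC) esp_openT esp_openI esp_open_bigU.

Lemma esp_openE (U : set (Esp hC)) : open U <-> exists X, U = Uc X.
Proof.
rewrite openE; split=> [Uo|[X ->] P UP].
  suff -> : U = \bigcup_(V : {V : set (Esp hC) | esp_open V /\ V `<=` U})
      sval V by apply: esp_open_bigU => -[V []].
  apply/seteqP; split=> P.
    by move=> /Uo [V [Vo VP VU]]; exists (exist _ V (conj Vo VU)).
  by move=> [[V [Vo VU]] _ /= /VU].
by exists (Uc X); split=> //; exists X.
Qed.

Lemma esp_closedE (Z : set (Esp hC)) : closed Z <-> exists X, Z = Zc X.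
Proof.
rewrite -openC esp_openE; split=> -[X XE]; exists X; last by rewrite XE.
by rewrite -[Z]setCK XE setCK.
Qed.

Definition PZ (Z : set (Esp hC)) : set E :=
  [set A | Uc [set A] `&` Z !=set0].

End EspTopology.

Definition irreducible (T : topologicalType) (Z : set T) :=
  forall A B : set T, closed A -> closed B ->
    Z `<=` A `|` B -> Z `<=` A \/ Z `<=` B.

Definition sober (T : topologicalType) :=
  forall Z : set T, Z !=set0 -> irreducible Z -> closed Z ->
    exists! p : T, closure [set p] = Z.

(* Main.v *)
Require Import Defs.
From mathcomp Require Import all_boot all_order all_algebra.
From mathcomp Require Import all_classical.
From mathcomp Require Import topology.

(** The closure of a point [P] consists of the [Q] in [C] contained in [P], so a
    generic point of [Z] can only be the union [PZ Z] of the members of [Z], and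
    it is one as soon as it belongs to [C]. Irreducibility of [Z] says that any
    two objects of [PZ Z] lie in a common member of [Z]; hence closure
    conditions with at most two premises, such as those defining [as_ E] and
    [Th E], pass from the members of [Z] to [PZ Z]. *)

Local Open Scope classical_set_scope.

Section EspSpace.
Context {E : additiveCat} {C : set (set E)} {hC : C `<=` as_ E}.
Implicit Types (P Q : Esp hC) (Z : set (Esp hC)).

Lemma closed_Zc (X : set E) : closed (Zc (hC := hC) X).
Proof. by apply/esp_closedE; exists X. Qed.

Lemma closure_pointP P Q :
  closure [set P] Q <-> sub_of Q `<=` sub_of P.
Proof.
split=> [PQ | QP].
  (* Missing the complement of [P] means lying inside [P], so this closed set has exactly the
     subsets of [P] as points. *)
  have sPZ : [set P] `<=` Zc (hC := hC) (~` sub_of P).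
    by move=> _ ->; exact: setICr.
  have := closureS sPZ PQ; rewrite -(closure_id _).1; last exact: closed_Zc.
  by move=> /subsets_disjoint.
have /esp_closedE[X clX] := @closed_closure _ [set P].
have : Zc (hC := hC) X P by rewrite -clX; exact: subset_closure.
rewrite clX /Zc/= => PX; rewrite -subset0 => A [QA XA].
by rewrite -PX; split=> //; exact: QP.
Qed.

Lemma sub_of_inj P Q : sub_of P = sub_of Q -> P = Q.
Proof. exact: val_inj. Qed.

Lemma PZP Z (A : E) : PZ Z A <-> exists2 P, Z P & sub_of P A.
Proof.
split=> [[P [/Uc1P PA ZP]] | [P ZP PA]]; first by exists P.
by exists P; split=> //; exact/Uc1P.
Qed.

(** A point is recovered from its closure, which gives both the uniqueness of generic points and the
    necessity of [C (PZ Z)]. *)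
Lemma PZ_closure P : PZ (closure [set P]) = sub_of P.
Proof.
apply/seteqP; split=> A.
  by move=> /PZP[Q /closure_pointP QP /QP].
by move=> PA; apply/PZP; exists P => //; exact/closure_pointP.
Qed.

(** With [Z = Zc X], every member of [Z] misses [X], hence so does their union, and so does each
    point contained in that union. *)
Lemma closure_PZ Z P : closed Z -> sub_of P = PZ Z -> closure [set P] = Z.
Proof.
move=> /esp_closedE[X ZX] PE; apply/seteqP; split=> Q.
  move=> /closure_pointP; rewrite PE ZX => QZ.
  rewrite /Zc/= -subset0 => A [/QZ/PZP[R RX RA] XA].
  by rewrite -RX.
move=> ZQ; apply/closure_pointP; rewrite PE => A QA.
by apply/PZP; exists Q.
Qed.

(** Otherwise each member of [Z] omits [A] or [B], so two closed sets cover [Z]; by irreducibility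
    one of them contains [Z], and [A] or [B] lies in no member. *)
Lemma PZ_pair Z (A B : E) : irreducible Z -> PZ Z A -> PZ Z B ->
  exists P, [/\ Z P, sub_of P A & sub_of P B].
Proof.
move=> Zirr [P [PA ZP]] [Q [QB ZQ]]; apply: contrapT => noR.
have [||R ZR|ZA|ZB] := Zirr (Zc (hC := hC) [set A]) (Zc (hC := hC) [set B]).
- exact: closed_Zc.
- exact: closed_Zc.
- apply: contrapT => /not_orP[RA RB].
  by apply: noR; exists R; split=> //; exact/Uc1P.
- exact: PA (ZA _ ZP).
- exact: QB (ZB _ ZQ).
Qed.

Lemma sober_PZ : sober (Esp hC) <->
  forall Z, Z !=set0 -> irreducible Z -> closed Z -> C (PZ Z).
Proof.
split=> [sob Z Z0 Zirr Zcl | CPZ Z Z0 Zirr Zcl].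
  have [P [<- _]] := sob Z Z0 Zirr Zcl.
  by rewrite PZ_closure; exact: sub_of_in.
have CZ := CPZ Z Z0 Zirr Zcl.
exists (SigSub (mem_set CZ) : Esp hC); split; first exact: closure_PZ.
by move=> Q QZ; apply: sub_of_inj; rewrite -(PZ_closure Q) QZ.
Qed.

Lemma as_PZ Z : Z !=set0 -> irreducible Z -> as_ E (PZ Z).
Proof.
move=> [P ZP] Zirr; split.
- have [[A PA] _ _] := hC _ (sub_of_in P).
  by exists A; apply/PZP; exists P.
- move=> A B S ZA ZB; have [Q [ZQ QA QB]] := PZ_pair Z A B Zirr ZA ZB.
  have [_ Qsum _] := hC _ (sub_of_in Q).
  by apply/PZP; exists Q => //; exact: Qsum.
(* A single premise: any member of [Z] containing the biproduct also contains both summands. *)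
- move=> A B S /PZP[Q ZQ QS]; have [_ _ Qsmd] := hC _ (sub_of_in Q).
  by have [QA QB] := Qsmd _ _ _ QS; split; apply/PZP; exists Q.
Qed.

End EspSpace.

Lemma Th_PZ (E : extriangulatedCat) (Z : set (Esp (@Th_as E))) :
  Z !=set0 -> irreducible Z -> Th E (PZ Z).
Proof.
move=> Z0 Zirr; split; first exact: as_PZ.
move=> L M N x y xy.
have thick (P : Esp (@Th_as E)) := (sub_of_in P).2 L M N x y xy.
by split=> ZA ZB; have [P [ZP PA PB]] := PZ_pair Z _ _ Zirr ZA ZB;
  have [PN PM PL] := thick P; apply/PZP; exists P => //; auto.
Qed.

Theorem theorem4p2 (E : extriangulatedCat) :
  (forall (C : set (set E)) (hC : C `<=` as_ E),
    (sober (Esp hC) <->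
      forall Z : set (Esp hC), Z !=set0 -> irreducible Z -> closed Z ->
        C (PZ Z)) /\
    (sober (Esp hC) ->
      forall Z : set (Esp hC), Z !=set0 -> irreducible Z -> closed Z ->
        exists P : Esp hC, sub_of P = PZ Z /\ Z = closure [set P])) /\
  sober (Esp (@subset_refl _ (as_ E))) /\
  sober (Esp (@Th_as E)).
Proof.
split=> [C hC|].
  split=> [|sob Z Z0 Zirr Zcl]; first exact: sober_PZ.
  (* Rewriting [Z] as the closure of its generic point [P] turns [PZ Z] into [sub_of P]. *)
  have [P [PE _]] := sob Z Z0 Zirr Zcl.
  by exists P; rewrite -PE PZ_closure.
split; apply/sober_PZ => Z Z0 Zirr _.
- exact: as_PZ.
- exact: Th_PZ.
Qed.
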